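(* Let $\lambda$ be a limit ordinal. For any D-sequent $\Psi\Rightarrow_{\mathsf D}\Phi$, the following four conditions are equivalent. (1) $\mathbf{D}^2_{\rm seq}\vdash\Psi\Rightarrow_{\mathsf D}\Phi$. (2) Analytic $\mathbf{D}^2_{\rm seq}\vdash\Psi\Rightarrow_{\mathsf D}\Phi$. (3) $\bigwedge\Psi\to\bigvee\Phi$ is true at the bottom of any constant $\lambda$-extension of any GL-model. (4) $\bigwedge\Psi\to\bigvee\Phi$ is true at the bottom of any $\lambda$-extension of any GL-model.
   Context: Formulas are built from propositional variables (the set of which is PropVar) and $\bot$ by $\to$ and $\Box$; other connectives are the usual classical abbreviations; the empty conjunction is $\top$ and the empty disjunction is $\bot$. $\Gamma,\Delta,\Pi,\Sigma,\ldots$ denote finite sets of formulas; commas denote union; $\Box\Gamma=\{\Box\gamma\mid\gamma\in\Gamma\}$; $\mathrm{Sub}(\Gamma)$ is the set of all subformulas of formulas in $\Gamma$. GL-sequents $\Gamma\Rightarrow\Delta$ and D-sequents $\Gamma\Rightarrow_{\mathsf D}\Delta$ are tagged pairs of finite sets of formulas. For each arrow $\blacktriangleright\in\{\Rightarrow,\Rightarrow_{\mathsf D}\}$, $\mathbf{LK}_{\blacktriangleright}$ has initial sequents $\varphi\blacktriangleright\varphi$ and $\bot\blacktriangleright\ $ (empty right side) and the rules: (weakening) from $\Gamma\blacktriangleright\Delta$ infer $\Gamma'\blacktriangleright\Delta'$, where $\Gamma\subseteq\Gamma'$, $\Delta\subseteq\Delta'$; ($\to$left) from $\Gamma\blacktriangleright\Delta,\varphi$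 and $\psi,\Gamma\blacktriangleright\Delta$ infer $\varphi\to\psi,\Gamma\blacktriangleright\Delta$; ($\to$right) from $\varphi,\Gamma\blacktriangleright\Delta,\psi$ infer $\Gamma\blacktriangleright\Delta,\varphi\to\psi$; (cut) from $\Gamma\blacktriangleright\Delta,\varphi$ and $\varphi,\Pi\blacktriangleright\Sigma$ infer $\Gamma,\Pi\blacktriangleright\Delta,\Sigma$. Further rules: (GL$\Box$) from $\Gamma,\Box\Gamma,\Box\varphi\Rightarrow\varphi$ infer $\Box\Gamma\Rightarrow\Box\varphi$; (GLtoD) from $\Gamma,\Box\Gamma\Rightarrow\Box\Delta$ infer $\Box\Gamma\Rightarrow_{\mathsf D}\Box\Delta$. $\mathbf{D}^2_{\rm seq}$ consists of $\mathbf{LK}_{\Rightarrow}$, $\mathbf{LK}_{\Rightarrow_{\mathsf D}}$, (GL$\Box$), (GLtoD). Analytic $\mathbf{D}^2_{\rm seq}$ is the restriction of $\mathbf{D}^2_{\rm seq}$ in which cut is allowed only in the form: from $\Gamma\Rightarrow_{\mathsf D}\Delta,\Box\varphi$ and $\Box\varphi,\Pi\Rightarrow_{\mathsf D}\Sigma$ infer $\Gamma,\Pi\Rightarrow_{\mathsf D}\Delta,\Sigma$, provided $\Box\varphi\in\mathrm{Sub}(\Gamma,\Delta,\Pi,\Sigma)$ (so no cuts on GL-sequents). Kripke semantics. A Kripke model $\langle W,\prec,V\rangle$ consists of a non-empty set $W$, a relation $\prec\subseteq W\times W$ and $V:W\times\mathrm{PropVar}\to\{\mathsf{true},\mathsf{false}\}$,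 extended to all formulas as usual, with $V(w,\Box\varphi)=\mathsf{true}$ iff $V(w',\varphi)=\mathsf{true}$ for all $w'$ with $w\prec w'$. A GL-model is one whose $\prec$ is transitive and converse well-founded (no infinite sequence $x_1\prec x_2\prec\cdots$). $\lambda$-extensions. For a limit ordinal $\lambda$, $\langle W^+,\prec^+\rangle$ is a $\lambda$-extension of $\langle W,\prec\rangle$ if for some $t_0\in W$: $W^+=W\uplus\{t_\alpha\mid 0<\alpha\le\lambda\}$ (disjoint union, the $t_\alpha$ distinct) and $\prec^+ = \prec\cup\{(t_\alpha,t_\beta)\mid 0\le\beta<\alpha\le\lambda\}\cup\{(t_\alpha,x)\mid 0<\alpha\le\lambda,\ t_0\prec x\}$. The world $t_\lambda$ is the bottom. A model $\langle W^+,\prec^+,V^+\rangle$ is a $\lambda$-extension of $\langle W,\prec,V\rangle$ if its frame is a $\lambda$-extension of $\langle W,\prec\rangle$ and $V^+$ coincides with $V$ on $W$. It is constant if $V^+(t_\alpha,p)=V^+(t_\beta,p)$ for all $p\in\mathrm{PropVar}$ and all $\alpha,\beta<\lambda$ (including index $0$). *)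

(* Defs.v *)
From HB Require Import structures.
From mathcomp Require Import all_boot all_order.
From mathcomp Require Import finmap.

Set Implicit Arguments.
Unset Strict Implicit.
Unset Printing Implicit Defensive.

Import Order.TTheory.
Local Open Scope order_scope.
Local Open Scope fset_scope.

Inductive formula (PropVar : Type) : Type :=
| Var of PropVar
| Bot
| Imp of formula PropVar & formula PropVar
| Box of formula PropVar.

Arguments Bot {PropVar}.

(* Formulas form a choiceType, as required by {fset formula PropVar}. *)
Section FormulaChoice.
Variable PropVar : Type.

Fixpoint formula_encode (f : formula PropVar) : GenTree.tree PropVar :=
  match f with
  | Var p => GenTree.Leaf p
  | Bot => GenTree.Node 0 [::]
  | Imp f g => GenTree.Node 1 [:: formula_encode f; formula_encode g]
  | Box f => GenTree.Node 2 [:: formula_encode f]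
  end.

Fixpoint formula_decode (t : GenTree.tree PropVar) : option (formula PropVar) :=
  match t with
  | GenTree.Leaf p => Some (Var p)
  | GenTree.Node 0 [::] => Some Bot
  | GenTree.Node 1 [:: t; u] =>
      obind (fun f => omap (Imp f) (formula_decode u)) (formula_decode t)
  | GenTree.Node 2 [:: t] => omap (@Box PropVar) (formula_decode t)
  | _ => None
  end.

Lemma formula_encodeK : pcancel formula_encode formula_decode.
Proof. by elim=> //= [f -> g -> | f ->]. Qed.

End FormulaChoice.

HB.instance Definition _ (PropVar : eqType) :=
  Equality.copy (formula PropVar) (pcan_type (@formula_encodeK PropVar)).
HB.instance Definition _ (PropVar : choiceType) :=
  Choice.copy (formula PropVar) (pcan_type (@formula_encodeK PropVar)).

Section Syntax.
Variable PropVar : choiceType.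
Implicit Types (f g : formula PropVar) (G D P S : {fset formula PropVar}).

Definition Neg f := Imp f Bot.
Definition Top : formula PropVar := Neg Bot.
Definition And f g := Neg (Imp f (Neg g)).
Definition Or f g := Imp (Neg f) g.

Definition conjunction G := \big[And/Top]_(f <- G) f.
Definition disjunction G := \big[Or/Bot]_(f <- G) f.

Definition boxes G : {fset formula PropVar} := [fset Box f | f in G].

Fixpoint subformulas f : {fset formula PropVar} :=
  f |` match f with
       | Var _ | Bot => fset0
       | Imp g h => subformulas g `|` subformulas h
       | Box g => subformulas g
       end.

Definition set_subformulas G : {fset formula PropVar} := \bigcup_(f <- G) subformulas f.

(* The tag of a sequent, i.e. its arrow. *)
Inductive arrow := ArrowGL | ArrowD.

(* cut_allowed a G D P S f: a cut on f is permitted between the premises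
   G a D,f and f,P a S. *)
Definition cut_condition :=
  arrow -> {fset formula PropVar} -> {fset formula PropVar} ->
  {fset formula PropVar} -> {fset formula PropVar} -> formula PropVar -> Prop.

Inductive derivable (cut_allowed : cut_condition) :
  arrow -> {fset formula PropVar} -> {fset formula PropVar} -> Prop :=
| Init a f :
    derivable cut_allowed a [fset f] [fset f]
| InitBot a :
    derivable cut_allowed a [fset Bot] fset0
| Weakening a G D G' D' :
    G `<=` G' -> D `<=` D' ->
    derivable cut_allowed a G D ->
    derivable cut_allowed a G' D'
| ImpLeft a G D f g :
    derivable cut_allowed a G (f |` D) ->
    derivable cut_allowed a (g |` G) D ->
    derivable cut_allowed a (Imp f g |` G) D
| ImpRight a G D f g :
    derivable cut_allowed a (f |` G) (g |` D) ->
    derivable cut_allowed a G (Imp f g |` D)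
| Cut a G D P S f :
    cut_allowed a G D P S f ->
    derivable cut_allowed a G (f |` D) ->
    derivable cut_allowed a (f |` P) S ->
    derivable cut_allowed a (G `|` P) (D `|` S)
| GLBox G f :
    derivable cut_allowed ArrowGL (Box f |` (G `|` boxes G)) [fset f] ->
    derivable cut_allowed ArrowGL (boxes G) [fset Box f]
| GLtoD G D :
    derivable cut_allowed ArrowGL (G `|` boxes G) (boxes D) ->
    derivable cut_allowed ArrowD (boxes G) (boxes D).

Definition any_cut : cut_condition := fun _ _ _ _ _ _ => True.

Definition analytic_cut : cut_condition := fun a G D P S f =>
  [/\ a = ArrowD, exists g, f = Box g & f \in set_subformulas (G `|` D `|` P `|` S)].

Definition D2seq := derivable any_cut.
Definition analytic_D2seq := derivable analytic_cut.

End Syntax.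

Record frame := Frame {
  world :> Type;
  frame_nonempty : inhabited world;
  acc : world -> world -> Prop
}.

Record model (PropVar : Type) := Model {
  model_frame :> frame;
  val : model_frame -> PropVar -> bool
}.

Fixpoint holds (PropVar : Type) (M : model PropVar) (w : M)
    (f : formula PropVar) : Prop :=
  match f with
  | Var p => val w p
  | Bot => False
  | Imp g h => holds w g -> holds w h
  | Box g => forall w', acc w w' -> holds w' g
  end.

Definition GL_frame (F : frame) : Prop :=
  (forall x y z : F, acc x y -> acc y z -> acc x z) /\
  ~ (exists x : nat -> F, forall n, acc (x n) (x n.+1)).

(* Ordinals are represented by the elements of a well-ordered type O with
   least element \bot (the ordinal 0); every ordinal arises as an element of
   such a type, up to isomorphism of initial segments. *)
Definition well_ordered (d : Order.disp_t) (O : bOrderType d) : Prop :=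
  well_founded (fun a b : O => a < b).

Definition limit_ordinal (d : Order.disp_t) (O : bOrderType d) (lambda : O) :=
  \bot < lambda /\ (forall a, a < lambda -> exists2 b, a < b & b < lambda).

Section LambdaExtension.
Variables (d : Order.disp_t) (O : bOrderType d) (lambda : O).

(* The inclusion of W in W^+ is given by the injection i, and t enumerates the
   worlds t_a for a <= lambda; the values of t above lambda are irrelevant. *)
Record frame_extension (F Fp : frame) (i : F -> Fp) (t : O -> Fp) (t0 : F) :
    Prop := FrameExtension {
  ext_incl_inj : forall x y, i x = i y -> x = y;
  ext_t0 : t \bot = i t0;
  ext_t_inj : forall a b,
    \bot < a <= lambda -> \bot < b <= lambda -> t a = t b -> a = b;
  ext_disjoint : forall x a, \bot < a <= lambda -> i x <> t a;
  ext_cover : forall y,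
    (exists x, y = i x) \/ (exists2 a, \bot < a <= lambda & y = t a);
  ext_acc : forall y z, acc y z <->
    [\/ exists x x', [/\ acc x x', y = i x & z = i x'],
        exists a b, [/\ b < a <= lambda, y = t a & z = t b]
      | exists a x, [/\ \bot < a <= lambda, acc t0 x, y = t a & z = i x]]
}.

Definition lambda_extension (PropVar : Type) (M Mp : model PropVar)
    (i : M -> Mp) (t : O -> Mp) : Prop :=
  (exists t0, frame_extension i t t0) /\
  (forall x p, val (i x) p = val x p).

Definition constant_lambda_extension (PropVar : Type) (M Mp : model PropVar)
    (i : M -> Mp) (t : O -> Mp) : Prop :=
  lambda_extension i t /\
  (forall a b p, a < lambda -> b < lambda -> val (t a) p = val (t b) p).

End LambdaExtension.

(* Main.v *)
(* Soundness of GLtoD: finitely many boxes failing at the bottom have witnesses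
   t_b with b below the limit or above t_0, so all of them already fail at a
   single t_a with a < lambda, where the left-hand side of the premise holds.

   Completeness: extend an underivable D-sequent to a maximal underivable one
   inside the set S of its subformulas; analytic cut decides every boxed formula
   of S, giving boxes A true and boxes B false. By GLtoD the GL-sequent
   A, Box A => Box B is underivable, hence refuted at a world t_0 of the canonical
   GL-model of maximal underivable sequents. As t_0 satisfies A together with
   Box A, its copies t_a (a < lambda) agree with t_0 on S, and the bottom, with
   variables valued by the maximal D-sequent, refutes that D-sequent. *)
Require Import Defs.
From mathcomp Require Import all_boot all_order finmap.
From Stdlib Require Import Classical ClassicalEpsilon.

Set Implicit Arguments.
Unset Strict Implicit.
Unset Printing Implicit Defensive.

Import Order.TTheory.
Local Open Scope order_scope.
Local Open Scope fset_scope.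

(** * Sequents as truth conditions at a world *)

Section Truth.
Variable PropVar : choiceType.
Implicit Types (f g : formula PropVar) (G D : {fset formula PropVar}).

Definition sequent_true (M : model PropVar) (w : M) G D :=
  (forall f, f \in G -> holds w f) -> exists2 f, f \in D & holds w f.

Lemma holds_conjunction (M : model PropVar) (w : M) G :
  holds w (conjunction G) <-> forall f, f \in G -> holds w f.
Proof.
rewrite /conjunction.
(* Passing to the underlying list of the finite set makes list induction available. *)
change (holds w (\big[@And PropVar/Top PropVar]_(f <- enum_fset G) f) <->
  forall f, f \in enum_fset G -> holds w f).
elim: (enum_fset G) => [|g s IHs].
  by rewrite big_nil; split=> [_ f | _ /=]; rewrite ?inE.
rewrite big_cons /=; split=> [conj f | all_s neg].
  (* [And] is encoded with [Imp] and [Neg], so its two parts are recovered classically. *)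
  have [Hg Hs] : holds w g /\ holds w (\big[@And PropVar/Top PropVar]_(h <- s) h).
    by split; apply: NNPP => nH; apply: conj => Hg Hs; apply: nH.
  by rewrite inE => /predU1P[-> // | fs]; apply: IHs.1 fs.
apply: neg; first by apply: all_s; rewrite inE eqxx.
by apply/IHs => f fs; apply: all_s; rewrite inE fs orbT.
Qed.

Lemma holds_disjunction (M : model PropVar) (w : M) G :
  holds w (disjunction G) <-> exists2 f, f \in G & holds w f.
Proof.
rewrite /disjunction.
change (holds w (\big[@Or PropVar/Bot]_(f <- enum_fset G) f) <->
  exists2 f, f \in enum_fset G & holds w f).
elim: (enum_fset G) => [|g s IHs].
  by rewrite big_nil; split=> [[] | [f]]; rewrite ?inE.
rewrite big_cons /=; split=> [disj | [f]].
  case: (classic (holds w g)) => [Hg | /disj/IHs[f fs Hf]].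
    by exists g; rewrite ?inE ?eqxx.
  by exists f; rewrite // inE fs orbT.
rewrite inE => /predU1P[-> // | fs] Hf _.
by apply/IHs; exists f.
Qed.

Lemma sequent_trueP (M : model PropVar) (w : M) G D :
  holds w (Imp (conjunction G) (disjunction D)) <-> sequent_true w G D.
Proof.
split=> /= H.
  by move=> HG; apply/holds_disjunction/H/holds_conjunction.
by move=> /holds_conjunction/H/holds_disjunction.
Qed.

Lemma sequent_false (M : model PropVar) (w : M) G D :
  (forall f, f \in G -> holds w f) -> (forall f, f \in D -> ~ holds w f) ->
  ~ sequent_true w G D.
Proof. by move=> HG HD /(_ HG)[f /HD]. Qed.

End Truth.

(** * Accessibility in lambda-extensions *)

Section Frames.

Definition acc_trans (F : frame) :=
  forall x y z : F, acc x y -> acc y z -> acc x z.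

Definition acc_cwf (F : frame) := well_founded (fun x y : F => acc y x).

(** By dependent choice: a world outside [Acc] has a successor outside [Acc], and iterating a chosen
    such successor yields an infinite chain. *)
Lemma no_chain_cwf (F : frame) :
  ~ (exists x : nat -> F, forall n, acc (x n) (x n.+1)) -> acc_cwf F.
Proof.
move=> no_chain x0; apply: NNPP => nAcc0; apply: no_chain.
pose T := {x : F | ~ Acc (fun x y : F => acc y x) x}.
have next (u : T) : exists v : T, acc (sval u) (sval v).
  case: u => x nAcc /=; apply: NNPP => no_next; case: nAcc.
  constructor=> y xy; apply: NNPP => nAccy.
  by case: no_next; exists (exist _ y nAccy).
pose nx u := sval (constructive_indefinite_description _ (next u)).
exists (fun n => sval (iter n nx (exist _ x0 nAcc0))) => n /=.
exact: (svalP (constructive_indefinite_description _ (next _))).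
Qed.

Variables (d : Order.disp_t) (O : bOrderType d) (lambda : O).
Variables (F Fp : frame) (i : F -> Fp) (t : O -> Fp) (t0 : F).
Hypothesis ext : frame_extension lambda i t t0.

Lemma ext_acc_tt a b : b < a <= lambda -> acc (t a) (t b).
Proof. by move=> ba; apply/(ext_acc ext); constructor 2; exists a, b. Qed.

Lemma ext_acc_tF a x : \bot < a <= lambda -> acc t0 x -> acc (t a) (i x).
Proof. by move=> ba H; apply/(ext_acc ext); constructor 3; exists a, x. Qed.

(** Disjointness excludes the two clauses of [ext_acc] that start at a [t a] with positive [a], so
    original worlds see nothing new. *)
Lemma ext_acc_F x y : acc (i x) y -> exists2 x', acc x x' & y = i x'.
Proof.
move/(ext_acc ext) => [[z [z' [zz' /(ext_incl_inj ext)-> ->]]]||].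
- by exists z'.
- move=> [a [b [/andP[ba al] ixa _]]]; exfalso.
  by apply: (ext_disjoint ext _ ixa); rewrite al (le_lt_trans (le0x b) ba).
- by move=> [a [z [al _ ixa _]]]; case: (ext_disjoint ext al ixa).
Qed.

Lemma ext_acc_t a y : \bot < a <= lambda -> acc (t a) y ->
  (exists2 b, b < a & y = t b) \/ (exists2 x, acc t0 x & y = i x).
Proof.
move=> al /(ext_acc ext) [[z [z' [_ /esym taz _]]]||].
- by case: (ext_disjoint ext al taz).
- move=> [a' [b [/andP[ba al'] taa ->]]]; left; exists b => //.
  rewrite (ext_t_inj ext al _ taa) // al' andbT.
  exact: le_lt_trans (le0x b) ba.
- by move=> [a' [x [_ H _ ->]]]; right; exists x.
Qed.

Lemma bot_or_pos a : a = \bot \/ \bot < a :> O.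
Proof. by case: (eqVneq a \bot) => [|]; [left | right; rewrite lt0x]. Qed.

Lemma ext_trans : acc_trans F -> acc_trans Fp.
Proof.
move=> Ftr y z u; case: (ext_cover ext y) => [[x ->] | [a al ->]].
  case/ext_acc_F=> x' xx' -> /ext_acc_F[x'' x'x'' ->].
  apply/(ext_acc ext); constructor 1; exists x, x''.
  by split=> //; apply: Ftr xx' x'x''.
case/(ext_acc_t al) => [[b ba ->] | [x t0x ->]]; last first.
  by case/ext_acc_F=> x' xx' ->; apply: ext_acc_tF al (Ftr _ _ _ t0x xx').
(* Index 0 is separate: [t \bot] is the original world [i t0], with the successors of [t0]. *)
case: (bot_or_pos b) => [-> | b_pos].
  by rewrite (ext_t0 ext) => /ext_acc_F[x' xx' ->]; apply: ext_acc_tF.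
have al' := andP al; have bl : b <= lambda by apply: le_trans (ltW ba) al'.2.
case/ext_acc_t => [|[c cb ->]|[x t0x ->]]; first by rewrite b_pos.
  by apply: ext_acc_tt; rewrite (lt_trans cb ba) al'.2.
exact: ext_acc_tF.
Qed.

(** Two inductions in sequence: over the original worlds, which see only one another, then over the
    index, since [t a] sees only original worlds and [t b] with [b < a]. *)
Lemma ext_cwf : well_ordered O -> acc_cwf F -> acc_cwf Fp.
Proof.
move=> O_wf Fwf; have AccF x : Acc (fun x y : Fp => acc y x) (i x).
  elim/(well_founded_ind Fwf): x => x IHx; constructor=> y /ext_acc_F[x' xx' ->].
  exact: IHx.
move=> y; case: (ext_cover ext y) => [[x ->] // | [a /andP[_ al] ->]] {y}.
elim/(well_founded_ind O_wf): a al => a IHa al.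
case: (bot_or_pos a) => [-> | a_pos]; first by rewrite (ext_t0 ext).
have al' : \bot < a <= lambda by rewrite a_pos.
constructor=> z /(ext_acc_t al')[[b ba ->] | [x _ -> //]].
by apply: IHa => //; apply: le_trans (ltW ba) al.
Qed.

End Frames.

(* The finitely many failures of boxed formulas at the bottom are all visible
   from some world below the limit. *)
Lemma ext_reflect_box (d : Order.disp_t) (O : bOrderType d) (PropVar : choiceType) (lambda : O)
    (M Mp : model PropVar) (i : M -> Mp) (t : O -> Mp) t0
    (D : seq (formula PropVar)) :
  frame_extension lambda i t t0 -> acc_trans M -> limit_ordinal lambda ->
  (forall f, f \in D -> ~ holds (t lambda) (Box f)) ->
  exists2 a, a < lambda & forall f, f \in D -> ~ holds (t a) (Box f).
Proof.
move=> ext Mtr [lam_pos lam_lim].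
have lamP : \bot < lambda <= lambda by rewrite lam_pos lexx.
elim: D => [|g D IHD] fail; first by exists \bot.
have [|a al faila] := IHD; first by move=> f fD; apply: fail; rewrite inE fD orbT.
have [y not_imp] : exists y, ~ (acc (t lambda) y -> holds y g).
  by apply: not_all_ex_not; apply: fail; rewrite inE eqxx.
have [lam_y ng] := imply_to_and _ _ not_imp.
(* Failure of a box passes to larger indices: by transitivity [t c] sees whatever [t b] sees. *)
have mono b c f : b < c -> c < lambda -> ~ holds (t b) (Box f) ->
    ~ holds (t c) (Box f).
  move=> bc cl nb /= Hc; apply: nb => z bz; apply: Hc.
  apply: (ext_trans ext Mtr) bz; apply: (ext_acc_tt ext).
  by rewrite bc ltW.
(* The counterexample [y] is some [t b] or an original world above [t0]; in the latter case every
   positive index sees it, so [\bot] serves as bound. *)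
have [b bl b_y] : exists2 b, b < lambda &
    forall c, b < c -> c < lambda -> acc (t c) y.
  case/(ext_acc_t ext lamP): lam_y => [[b bl ->] | [x t0x ->]].
    by exists b => // c bc cl; apply: (ext_acc_tt ext); rewrite bc ltW.
  exists \bot => // c bc cl; apply: (ext_acc_tF ext) => //.
  by rewrite bc ltW.
(* The limit property gives an index [c] strictly beyond both bounds, where the new box and the
   earlier ones fail together. *)
have ml : Order.max a b < lambda by rewrite gt_max al.
have [c] := lam_lim _ ml; rewrite gt_max => /andP[ac bc] cl.
exists c => // f; rewrite inE => /predU1P[-> /= Hc | /faila].
  by apply: ng; apply: Hc; apply: b_y.
exact: mono.
Qed.

(** * Soundness of the calculus with arbitrary cuts *)

Section Soundness.
Variables (PropVar : choiceType) (d : Order.disp_t) (O : bOrderType d).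
Variable lambda : O.
Hypotheses (O_wf : well_ordered O) (lambda_limit : limit_ordinal lambda).

(** GL-sequents are tested at all worlds of transitive converse well-founded models; the extension
    is one of these, so the premise of [GLtoD] can be evaluated at its world [t a]. *)
Definition admissible_world (a : arrow) (M : model PropVar) (w : M) : Prop :=
  match a with
  | ArrowGL => acc_trans M /\ acc_cwf M
  | ArrowD => exists (M0 : model PropVar) (i : M0 -> M) (t : O -> M),
      [/\ GL_frame M0, lambda_extension lambda i t & w = t lambda]
  end.

Lemma in_boxes (G : {fset formula PropVar}) f : (Box f \in boxes G) = (f \in G).
Proof. by rewrite mem_imfset //= => ? ? []. Qed.

Lemma soundness C a (G D : {fset formula PropVar}) : derivable C a G D ->
  forall (M : model PropVar) (w : M), admissible_world a w -> sequent_true w G D.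
Proof.
elim=> {a G D}.
- by move=> a f M w _ HG; exists f; [rewrite inE | apply: HG; rewrite inE].
- by move=> a M w _ /(_ Bot); rewrite inE eqxx => /(_ isT).
- move=> a G D G' D' /fsubsetP sG /fsubsetP sD _ IH M w /IH H HG'.
  by have [f /sG/HG' //|f /sD] := H; exists f.
- move=> a G D f g _ IH1 _ IH2 M w adm HG.
  have HG' h : h \in G -> holds w h by move=> hG; apply: HG; rewrite !inE hG orbT.
  have [|h] := IH1 M w adm; first by [].
  rewrite !inE => /predU1P[-> Hf | hD Hh]; last by exists h.
  have Hg : holds w g by apply: (HG (Imp f g)); rewrite ?inE ?eqxx.
  by apply: IH2 => // h'; rewrite !inE => /predU1P[-> // | /HG'].
- move=> a G D f g _ IH M w adm HG.
  case: (classic (holds w f)) => [Hf | nHf]; last first.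
    by exists (Imp f g); rewrite ?inE ?eqxx.
  have [|h] := IH M w adm.
    by move=> h; rewrite !inE => /predU1P[-> // | /HG].
  rewrite !inE => /predU1P[-> Hg | hD Hh]; last by exists h; rewrite ?inE ?hD ?orbT.
  by exists (Imp f g); rewrite ?inE ?eqxx.
- move=> a G D P S f _ _ IH1 _ IH2 M w adm HGP.
  have [|h] := IH1 M w adm.
    by move=> h hG; apply: HGP; rewrite inE hG.
  rewrite !inE => /predU1P[-> Hf | hD Hh]; last by exists h; rewrite ?inE ?hD.
  have [|k kS Hk] := IH2 M w adm; last by exists k; rewrite ?inE ?kS ?orbT.
  by move=> k; rewrite !inE => /predU1P[-> // | hP]; apply: HGP; rewrite inE hP orbT.
- move=> G f _ IH M w [Mtr Mwf] HG.
  exists (Box f); first by rewrite inE.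
  have {}HG g : g \in G -> holds w (Box g) by rewrite -in_boxes => /HG.
  (* Löb's argument: the induction hypothesis at the successors of [x] is exactly [Box f] at [x],
     the diagonal formula of the premise. *)
  move=> /= x; elim/(well_founded_ind Mwf): x => x IHx wx.
  have [|h] := IH M x (conj Mtr Mwf); last by rewrite inE => /eqP->.
  move=> h; rewrite !inE => /or3P[/eqP-> /= y xy | /HG Hh | ].
  + by apply: IHx => //; apply: Mtr wx xy.
  + exact: Hh.
  + case/imfsetP=> g /= gG -> y xy; apply: (HG g gG).
    exact: Mtr wx xy.
- move=> G D _ IH M _ [M0 [i [t [[M0tr /no_chain_cwf M0wf] [[t0 ext] _] ->]]]] HG.
  have Mtr := ext_trans ext M0tr; have Mwf := ext_cwf ext O_wf M0wf.
  apply: NNPP => fail.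
  have [|a al faila] := ext_reflect_box (D := D) ext M0tr lambda_limit.
    by move=> f fD HBf; apply: fail; exists (Box f); rewrite ?in_boxes.
  have lam_a : acc (t lambda) (t a) by apply: (ext_acc_tt ext); rewrite al lexx.
  have [|f|h /imfsetP[f /= fD ->]] := IH M (t a); last exact: faila.
    by [].
  rewrite inE => /orP[fG | fG].
    by have := HG (Box f); rewrite in_boxes fG => /(_ isT _ lam_a).
  by move: fG (HG f fG) => /imfsetP[g /= gG ->] Hg y ay; apply: Hg; apply: Mtr lam_a ay.
Qed.

End Soundness.

Lemma derivable_mono (PropVar : choiceType) (C C' : cut_condition PropVar) :
  (forall a G D P S f, C a G D P S f -> C' a G D P S f) ->
  forall a G D, derivable C a G D -> derivable C' a G D.
Proof.
move=> sC a G D; elim=> {a G D}; try by econstructor; eauto.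
Qed.

(** * Maximal underivable sequents *)

Section Saturation.
Variable PropVar : choiceType.
Implicit Types (f g : formula PropVar) (G D S : {fset formula PropVar}).

Notation provable := (@analytic_D2seq PropVar).

(** Maximality is stated through derivability: with cut restricted, a formula of [S] may lie on
    neither side. *)
Record saturated S a G D : Prop := Saturated {
  sat_subl : G `<=` S;
  sat_subr : D `<=` S;
  sat_unprovable : ~ provable a G D;
  sat_maxl : forall f, f \in S -> f \notin G -> provable a (f |` G) D;
  sat_maxr : forall f, f \in S -> f \notin D -> provable a G (f |` D) }.

(** Each added formula lowers the number of formulas of [S] missing on the left or on the right. *)
Lemma saturation S a G D : G `<=` S -> D `<=` S -> ~ provable a G D ->
  exists G' D', [/\ saturated S a G' D', G `<=` G' & D `<=` D'].
Proof.
have [n] := ubnP (#|` S `\` G| + #|` S `\` D|)%N.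
elim: n G D => // n IHn G D ltn sG sD unp.
have lt_fsetD f A : f \in S -> f \notin A -> (#|` S `\` (f |` A)| < #|` S `\` A|)%N.
  move=> fS fA; apply: fproper_ltn_card; rewrite fproperE; apply/andP; split.
    by apply/fsubsetP => g; rewrite !inE negb_or -andbA => /and3P[_ -> ->].
  by apply/negP => /fsubsetP/(_ f); rewrite !inE fS fA eqxx => /(_ isT).
have [[f [fS fG unpf]] | maxl] :=
  classic (exists f, [/\ f \in S, f \notin G & ~ provable a (f |` G) D]).
  have [||G' [D' [sat GG' DD']]] := IHn (f |` G) D _ _ sD unpf.
  - by rewrite -ltnS; apply: leq_trans ltn; rewrite ltnS ltn_add2r lt_fsetD.
  - by rewrite fsubUset sG fsub1set fS.
  by exists G', D'; split=> //; apply: fsubset_trans GG'; apply: fsubsetU1.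
have [[f [fS fD unpf]] | maxr] :=
  classic (exists f, [/\ f \in S, f \notin D & ~ provable a G (f |` D)]).
  have [||G' [D' [sat GG' DD']]] := IHn G (f |` D) _ sG _ unpf.
  - by rewrite -ltnS; apply: leq_trans ltn; rewrite ltnS ltn_add2l lt_fsetD.
  - by rewrite fsubUset sD fsub1set fS.
  by exists G', D'; split=> //; apply: fsubset_trans DD'; apply: fsubsetU1.
exists G, D; split=> //; split=> // f fS fN; apply: NNPP => unpf.
  by apply: maxl; exists f.
by apply: maxr; exists f.
Qed.

Variables (S : {fset formula PropVar}).
Hypothesis S_imp : forall f g, Imp f g \in S -> f \in S /\ g \in S.
Hypothesis S_box : forall f, Box f \in S -> f \in S.

Section Theory.
Variables (a : arrow) (G D : {fset formula PropVar}).
Hypothesis sat : saturated S a G D.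

Lemma sat_disjoint f : f \in G -> f \in D -> False.
Proof.
move=> fG fD; apply: (sat_unprovable sat).
by apply: Weakening (Init _ _ f); rewrite fsub1set.
Qed.

Lemma sat_Bot : Bot \notin G.
Proof.
apply/negP => fG; apply: (sat_unprovable sat).
by apply: Weakening (InitBot _ _); rewrite ?fsub1set ?fsub0set.
Qed.

(** Otherwise maximality derives both premises of [ImpLeft], whose conclusion is the saturated
    sequent because the implication already lies in [G]. *)
Lemma sat_ImpL f g : Imp f g \in G -> f \in D \/ g \in G.
Proof.
move=> fgG; have [fS gS] := S_imp (fsubsetP (sat_subl sat) _ fgG).
case: (boolP (f \in D)) => [|fD]; first by left.
case: (boolP (g \in G)) => [|gG]; first by right.
case: (sat_unprovable sat).
rewrite -(mem_fset1U fgG); apply: ImpLeft.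
  exact: (sat_maxr sat).
exact: (sat_maxl sat).
Qed.

Lemma sat_ImpR f g : Imp f g \in D -> f \in G /\ g \in D.
Proof.
move=> fgD; have [fS gS] := S_imp (fsubsetP (sat_subr sat) _ fgD).
(* A missing [f] or [g] would make this sequent derivable by maximality and weakening. *)
have unp : ~ provable a (f |` G) (g |` D).
  by move=> p; apply: (sat_unprovable sat); rewrite -(mem_fset1U fgD); apply: ImpRight.
split; apply/negPn/negP => N; apply: unp.
  by apply: Weakening (sat_maxl sat fS N); rewrite ?fsubsetU1 ?fsubset_refl.
by apply: Weakening (sat_maxr sat gS N); rewrite ?fsubsetU1 ?fsubset_refl.
Qed.

(** Boxed formulas are left to hypotheses because at the bottom of an extension the copies of [t0]
    settle them. *)
Lemma sat_holds (M : model PropVar) (w : M) :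
  (forall p, Var p \in S -> Defs.val w p = (Var p \in G)) ->
  (forall f, Box f \in G -> holds w (Box f)) ->
  (forall f, Box f \in D -> ~ holds w (Box f)) ->
  forall f, (f \in G -> holds w f) /\ (f \in D -> ~ holds w f).
Proof.
move=> Hvar HG HD; elim=> [p||f [fG fD] g [gG gD]|f _]; last by split; auto.
- split=> /= fX.
    by rewrite Hvar // (fsubsetP (sat_subl sat)).
  rewrite Hvar; first by move=> fG; apply: (sat_disjoint fG fX).
  exact: (fsubsetP (sat_subr sat)).
- by split=> [BG | _ []]; case/negP: sat_Bot.
- split=> /= [/sat_ImpL[/fD nf /nf // | /gG //] | /sat_ImpR[/fG Hf /gD Hg] /= H].
  exact/Hg/H.
Qed.

End Theory.

(** The comprehension over subformulas keeps the set finite and excludes nothing, as [f] is a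
    subformula of [Box f]. *)
Definition unboxed G := [fset f in set_subformulas G | Box f \in G].

Lemma subformulas_refl f : f \in subformulas f.
Proof. by case: f => *; rewrite /= !inE eqxx. Qed.

Lemma in_set_subformulas G f :
  f \in set_subformulas G <-> exists2 g, g \in G & f \in subformulas g.
Proof.
split=> [/bigfcupP[g /andP[gG _] fg] | [g gG fg]]; first by exists g.
by apply/bigfcupP; exists g; rewrite ?gG.
Qed.

Lemma in_unboxed G f : (f \in unboxed G) = (Box f \in G).
Proof.
rewrite !inE /=; case: (boolP (Box f \in G)) => fG; rewrite ?andbF ?andbT //.
apply/in_set_subformulas; exists (Box f) => //=.
by rewrite !inE subformulas_refl orbT.
Qed.

Lemma boxes_unboxed_sub G : boxes (unboxed G) `<=` G.
Proof.
by apply/fsubsetP => _ /imfsetP[f /= fG ->]; rewrite -in_unboxed.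
Qed.

Definition is_box f := if f is Box _ then true else false.

Definition box_count G := #|` [fset f in G | is_box f]|.

(** * The canonical GL-model *)

Section CanonicalModel.
Variable GD0 : {GD : {fset formula PropVar} * {fset formula PropVar} |
  saturated S ArrowGL GD.1 GD.2}.

(* The second clause makes the set of boxed formulas, which is contained in
   [S], grow strictly along the relation; hence converse well-foundedness. *)
Definition canonical_acc (G G' : {fset formula PropVar}) :=
  (forall f, Box f \in G -> f \in G' /\ Box f \in G') /\
  (exists2 f, Box f \in G' & Box f \notin G).

Lemma box_count_acc G G' : canonical_acc G G' -> (box_count G < box_count G')%N.
Proof.
move=> [sub [f fG' fG]]; apply: fproper_ltn_card; rewrite fproperE; apply/andP; split.
  by apply/fsubsetP => -[p || h k | g]; rewrite !inE ?andbF // => /andP[/sub[_ ->]].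
by apply/negP => /fsubsetP/(_ (Box f)); rewrite !inE fG' (negPf fG) => /(_ isT).
Qed.

Definition canonical_frame : frame :=
  @Frame {GD : {fset formula PropVar} * {fset formula PropVar} |
           saturated S ArrowGL GD.1 GD.2}
         (inhabits GD0) (fun w w' => canonical_acc (sval w).1 (sval w').1).

Definition canonical_model : model PropVar :=
  @Model _ canonical_frame (fun w p => Var p \in (sval w).1).

Lemma canonical_GL : GL_frame canonical_model.
Proof.
split=> [x y z [xy _] [yz [f fz fy]] | [x chain]].
  split=> [g /xy[_ /yz //] | ]; exists f => //.
  by apply: contra fy => /xy[].
(* The count of boxes is at least [n] at the [n]-th world of a chain; at index one more than the
   size of [S] this exceeds that size. *)
have grow n : (n <= box_count (sval (x n)).1)%N.
  by elim: n => // n IHn; apply: leq_ltn_trans IHn (box_count_acc (chain n)).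
have := grow #|` S|.+1; rewrite leqNgt ltnS fsubset_leq_card //.
apply/fsubsetP => f; rewrite !inE => /andP[fG _].
exact: (fsubsetP (sat_subl (svalP (x #|` S|.+1)))).
Qed.

Lemma canonical_holds (w : canonical_model) f :
  (f \in (sval w).1 -> holds w f) /\ (f \in (sval w).2 -> ~ holds w f).
Proof.
elim: f w => [p|| f IHf g IHg | f IHf] w.
- split=> //= fD fG; exact: (sat_disjoint (svalP w) fG fD).
- by split=> [BG | _ []]; case/negP: (sat_Bot (svalP w)).
- have [[fG fD] [gG gD]] := (IHf w, IHg w).
  split=> /= [/(sat_ImpL (svalP w))[/fD nf /nf // | /gG //] |].
  by move=> /(sat_ImpR (svalP w))[/fG Hf /gD Hg] /= /(_ Hf).
split=> [fG w' [/(_ _ fG)[fG' _] _] | fD Hf]; first exact: (IHf w').1.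
have sat := svalP w; set G := (sval w).1 in sat; set D := (sval w).2 in sat fD.
(* Otherwise [GLBox] and weakening would derive the saturated sequent itself. *)
have unp : ~ provable ArrowGL (Box f |` (unboxed G `|` boxes (unboxed G))) [fset f].
  move/GLBox => p; apply: (sat_unprovable sat).
  by apply: Weakening p; rewrite ?boxes_unboxed_sub ?fsub1set.
have sG := fsubsetP (sat_subl sat); have fS := fsubsetP (sat_subr sat) _ fD.
have [|| G' [D' [sat' sG' sD']]] := @saturation S _ _ _ _ _ unp.
- apply/fsubsetP => g; rewrite in_fset1U in_fsetU in_unboxed.
  case/or3P => [/eqP-> // | /sG/S_box // | gG].
  exact: sG (fsubsetP (boxes_unboxed_sub _) _ gG).
- by rewrite fsub1set S_box.
pose w' : canonical_model := exist _ (G', D') sat'.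
have fD' : f \in D' by rewrite -fsub1set.
apply: ((IHf w').2 fD'); apply: Hf; split=> [g gG | ].
  split; apply: (fsubsetP sG'); rewrite in_fset1U in_fsetU in_unboxed ?gG ?orbT //.
  by rewrite in_boxes in_unboxed gG !orbT.
(* The diagonal formula [Box f] is the new box that [canonical_acc] asks for: it is in [G'], and not
   in [G] since it lies in [D]. *)
exists f; first by apply: (fsubsetP sG'); rewrite !inE eqxx.
by apply/negP => fG; apply: (sat_disjoint sat fG fD).
Qed.

End CanonicalModel.
End Saturation.

(** * A constant extension over a given world *)

Section ConstantExtension.
Variables (PropVar : choiceType) (d : Order.disp_t) (O : bOrderType d) (lambda : O).
Variables (M : model PropVar) (t0 : M) (V : PropVar -> bool).
Hypothesis lam_pos : \bot < lambda.

Definition cext_world := (M + {a : O | \bot < a <= lambda})%type.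

(** The clause [x = t0] stands for index 0, which is represented in the first summand. *)
Definition cext_acc (y z : cext_world) : Prop :=
  match y, z with
  | inl x, inl x' => acc x x'
  | inl _, inr _ => False
  | inr _, inl x => x = t0 \/ acc t0 x
  | inr a, inr b => sval b < sval a
  end.

(** At [\bot] the fallback [inl t0] is the required identification; above [lambda] it is a default
    value. *)
Definition cext_t (a : O) : cext_world :=
  if insub a is Some u then inr u else inl t0.

(** Constancy concerns only indices below [lambda], so the bottom can be valued freely by [V]. *)
Definition cext_val (y : cext_world) (p : PropVar) : bool :=
  match y with
  | inl x => Defs.val x p
  | inr a => if sval a == lambda then V p else Defs.val t0 p
  end.

Definition cext_model : model PropVar :=
  @Model _ (@Frame cext_world (inhabits (inl t0)) cext_acc) cext_val.

Lemma cext_t_bot : cext_t \bot = inl t0.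
Proof. by rewrite /cext_t insubF // ltxx. Qed.

Lemma cext_t_pos a (ap : \bot < a <= lambda) : cext_t a = inr (exist _ a ap).
Proof. by rewrite /cext_t (insubT (fun a => \bot < a <= lambda) ap). Qed.

Lemma cext_val_lambda p : Defs.val (cext_t lambda : cext_model) p = V p.
Proof.
have lamP : \bot < lambda <= lambda by rewrite lam_pos lexx.
by rewrite (cext_t_pos lamP) /= eqxx.
Qed.

Lemma cext_val_below a p : a < lambda ->
  Defs.val (cext_t a : cext_model) p = Defs.val t0 p.
Proof.
move=> al; case: (bot_or_pos a) => [-> | a_pos]; first by rewrite cext_t_bot.
have ap : \bot < a <= lambda by rewrite a_pos ltW.
by rewrite (cext_t_pos ap) /= lt_eqF.
Qed.

Lemma cext_frame : frame_extension lambda (inl : M -> cext_model) cext_t t0.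
Proof.
split=> [x y [] // | | a b ap bp | x a ap | [x | [a ap]] | y z].
- exact: cext_t_bot.
- by rewrite (cext_t_pos ap) (cext_t_pos bp) => -[].
- by rewrite (cext_t_pos ap).
- by left; exists x.
- by right; exists a => //; rewrite cext_t_pos.
split; last first.
  case=> [[x [x' [xx' -> ->]]] // | [a [b [/andP[ba al] -> ->]]] | [a [x [ap t0x -> ->]]]].
    have ap : \bot < a <= lambda by rewrite al (le_lt_trans (le0x b) ba).
    rewrite (cext_t_pos ap); case: (bot_or_pos b) => [-> | b_pos].
      by rewrite cext_t_bot; left.
    have bp : \bot < b <= lambda by rewrite b_pos (le_trans (ltW ba) al).
    by rewrite (cext_t_pos bp).
  by rewrite (cext_t_pos ap); right.
case: y z => [x | [a ap]] [x' | [b bp]] //=.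
- by move=> xx'; constructor 1; exists x, x'.
- case=> [-> | t0x]; last first.
    by constructor 3; exists a, x'; split; rewrite ?cext_t_pos.
  constructor 2; exists a, \bot; split; rewrite ?cext_t_bot ?cext_t_pos //.
- move=> ba; constructor 2; exists a, b; rewrite !cext_t_pos; split=> //.
  by rewrite ba; case/andP: ap.
Qed.

Lemma cext_constant : constant_lambda_extension lambda (inl : M -> cext_model) cext_t.
Proof.
split; first by split=> //; exists t0; apply: cext_frame.
by move=> a b p al bl; rewrite !cext_val_below.
Qed.

End ConstantExtension.

(** * Subformula closure and the countermodel *)

Section Completeness.
Variable PropVar : choiceType.
Implicit Types (f g h : formula PropVar) (G D : {fset formula PropVar}).

Lemma subformulas_trans f g h :
  f \in subformulas g -> g \in subformulas h -> f \in subformulas h.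
Proof.
move=> fg; elim: h => [p || h IHh k IHk | h IHh] /=.
- by rewrite !inE orbF => /eqP gE; move: fg; rewrite gE /= !inE.
- by rewrite !inE orbF => /eqP gE; move: fg; rewrite gE /= !inE.
- rewrite in_fset1U in_fsetU => /or3P[/eqP gE | /IHh fh | /IHk fk].
  + by move: fg; rewrite gE.
  + by rewrite in_fset1U in_fsetU fh orbT.
  + by rewrite in_fset1U in_fsetU fk !orbT.
- rewrite in_fset1U => /orP[/eqP gE | /IHh fh]; first by move: fg; rewrite gE.
  by rewrite in_fset1U fh orbT.
Qed.

Lemma set_subformulas_closed G f g :
  f \in subformulas g -> g \in set_subformulas G -> f \in set_subformulas G.
Proof.
move=> fg /in_set_subformulas[h hG gh]; apply/in_set_subformulas.
by exists h => //; apply: subformulas_trans gh.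
Qed.

Lemma set_subformulas_refl G : G `<=` set_subformulas G.
Proof.
apply/fsubsetP => f fG; apply/in_set_subformulas; exists f => //.
exact: subformulas_refl.
Qed.

Lemma set_subformulasS G D : G `<=` D -> set_subformulas G `<=` set_subformulas D.
Proof.
move/fsubsetP => sGD; apply/fsubsetP => f /in_set_subformulas[g /sGD gD fg].
by apply/in_set_subformulas; exists g.
Qed.

Lemma completeness (d : Order.disp_t) (O : bOrderType d) (lambda : O)
    (lam_pos : \bot < lambda) G D :
  ~ analytic_D2seq ArrowD G D ->
  exists (M Mp : model PropVar) (i : M -> Mp) (t : O -> Mp),
    [/\ GL_frame M, constant_lambda_extension lambda i t &
        ~ sequent_true (t lambda) G D].
Proof.
move=> unp; pose S := set_subformulas (G `|` D).
have S_imp f g : Imp f g \in S -> f \in S /\ g \in S.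
  move=> fgS; split; apply: set_subformulas_closed fgS => /=;
  by rewrite !inE subformulas_refl !orbT.
have S_box f : Box f \in S -> f \in S.
  by apply: set_subformulas_closed; rewrite /= !inE subformulas_refl orbT.
have /fsubUsetP[GS DS] : G `|` D `<=` S := set_subformulas_refl _.
have [G' [D' [sat sG sD]]] := saturation GS DS unp.
(* The one appeal to cut in the completeness argument. It is analytic because [S] consists of
   subformulas of [G] and [D], which are contained in [G'] and [D']. *)
have box_cut f : Box f \in S -> Box f \in G' \/ Box f \in D'.
  move=> fS; apply: NNPP => /not_or_and[/negP fG /negP fD].
  apply: (sat_unprovable sat); rewrite -(fsetUid G') -(fsetUid D').
  apply: Cut (sat_maxr sat fS fD) (sat_maxl sat fS fG); split=> //.
    by exists f.
  apply: (fsubsetP (set_subformulasS _)) fS.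
  by rewrite -fsetUA fsubsetU // fsetUSS.
have unpGL : ~ analytic_D2seq ArrowGL
    (unboxed G' `|` boxes (unboxed G')) (boxes (unboxed D')).
  move/GLtoD => p; apply: (sat_unprovable sat).
  by apply: Weakening p; apply: boxes_unboxed_sub.
have G'S := fsubsetP (sat_subl sat); have D'S := fsubsetP (sat_subr sat).
have [|| G0 [D0 [sat0 sG0 sD0]]] := @saturation _ S _ _ _ _ _ unpGL.
- apply/fsubsetP => f; rewrite in_fsetU in_unboxed => /orP[/G'S/S_box // | fG].
  exact: G'S (fsubsetP (boxes_unboxed_sub _) _ fG).
- by apply: fsubset_trans (sat_subr sat); apply: boxes_unboxed_sub.
pose t0 : canonical_frame (exist _ (G0, D0) sat0) := exist _ (G0, D0) sat0.
pose M : model PropVar := canonical_model t0.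
have truth0 f := canonical_holds (GD0 := t0) S_imp S_box t0 f.
have boxL f : Box f \in G' -> holds (t0 : M) f /\ holds (t0 : M) (Box f).
  by move=> fG; split; apply: (truth0 _).1; apply: (fsubsetP sG0);
     rewrite in_fsetU ?in_boxes in_unboxed fG ?orbT.
have boxR f : Box f \in D' -> ~ holds (t0 : M) (Box f).
  move=> fD; apply: (truth0 _).2; apply: (fsubsetP sD0).
  by rewrite in_boxes in_unboxed.
pose V p := Var p \in G'.
pose Mp := cext_model lambda (t0 : M) V.
pose t : O -> Mp := cext_t lambda (t0 : M).
pose i : M -> Mp := inl.
have cst : constant_lambda_extension lambda i t := cext_constant _ _ _.
have ext : frame_extension lambda i t t0 := cext_frame _ _ _.
exists M, Mp, i, t; split=> //; first exact: canonical_GL.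
have holds_i f (x : M) : holds (i x) f <-> holds x f.
  elim: f x => [p || f IHf g IHg | f IHf] x //=.
    by rewrite IHf IHg.
  split=> H y xy.
    by apply/IHf; apply: H.
  by have [x' xx' ->] := ext_acc_F ext xy; apply/IHf; apply: H.
have box_t a f : \bot < a <= lambda ->
    (holds (t a : Mp) (Box f) <->
      (forall b, b < a -> holds (t b : Mp) f) /\ holds (t0 : M) (Box f)).
  move=> al; have /andP[_ al'] := al; split=> [H | [Ht H0] y].
    split=> [b ba | x t0x]; first by apply: H; apply: (ext_acc_tt ext); rewrite ba.
    by apply/holds_i; apply: H; apply: (ext_acc_tF ext al t0x).
  case/(ext_acc_t ext al) => [[b ba ->] | [x t0x ->]]; first exact: Ht.
  by apply/holds_i; apply: H0.
(* A box in [G'] gives [f] at [t0], hence by induction at all lower copies; a box in [D'] fails at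
   [t0] and so at [t a]. *)
have same f : f \in S -> forall a, a < lambda ->
    holds (t a : Mp) f <-> holds (t0 : M) f.
  elim: f => [p _ || f IHf g IHg /S_imp[fS gS] | f IHf fS] a al //.
  - by have := @cext_val_below _ _ _ lambda M t0 V a p al; rewrite /= => ->.
  - by rewrite /= (IHf fS a al) (IHg gS a al).
  case: (bot_or_pos a) => [-> | a_pos].
    by rewrite /t cext_t_bot -/(i t0) holds_i.
  have al' : \bot < a <= lambda by rewrite a_pos ltW.
  rewrite box_t //; case: (box_cut f fS) => [/boxL[Hf Hbf] | /boxR nf]; last by tauto.
  split=> [[] // | _]; split=> // b ba.
  by apply/(IHf (S_box _ fS)) => //; apply: lt_trans al.
have lamP : \bot < lambda <= lambda by rewrite lam_pos lexx.
have truth f : (f \in G' -> holds (t lambda) f) /\ (f \in D' -> ~ holds (t lambda) f).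
  apply: (sat_holds S_imp sat) => [p _ | g gG | g gD]; first exact: cext_val_lambda.
  - have [Hg Hbg] := boxL g gG; apply/box_t => //; split=> // b bl.
    by apply/same => //; apply/S_box/G'S.
  (* The bottom sees every successor of [t0], so a box failing at [t0] fails here too. *)
  - by move/box_t => /(_ lamP)[_]; apply: boxR.
by apply: sequent_false => f fX; [apply: (truth f).1 | apply: (truth f).2];
   [apply: (fsubsetP sG) | apply: (fsubsetP sD)].
Qed.

End Completeness.

Theorem theorem5p7 (PropVar : choiceType)
    (d : Order.disp_t) (O : bOrderType d) (lambda : O)
    (O_wf : well_ordered O) (lambda_limit : limit_ordinal lambda)
    (Psi Phi : {fset formula PropVar}) :
  [<-> D2seq ArrowD Psi Phi;
       analytic_D2seq ArrowD Psi Phi;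
       forall (M Mp : model PropVar) (i : M -> Mp) (t : O -> Mp),
         GL_frame M -> constant_lambda_extension lambda i t ->
         holds (t lambda) (Imp (conjunction Psi) (disjunction Phi));
       forall (M Mp : model PropVar) (i : M -> Mp) (t : O -> Mp),
         GL_frame M -> lambda_extension lambda i t ->
         holds (t lambda) (Imp (conjunction Psi) (disjunction Phi))].
Proof.
have sound : D2seq ArrowD Psi Phi ->
    forall (M Mp : model PropVar) (i : M -> Mp) (t : O -> Mp),
      GL_frame M -> lambda_extension lambda i t ->
      holds (t lambda) (Imp (conjunction Psi) (disjunction Phi)).
  move=> p M Mp i t GL ext; apply/sequent_trueP.
  by apply: (soundness O_wf lambda_limit p); exists M, i, t.
have weaken : analytic_D2seq ArrowD Psi Phi -> D2seq ArrowD Psi Phi.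
  exact: derivable_mono.
have complete : (forall (M Mp : model PropVar) (i : M -> Mp) (t : O -> Mp),
      GL_frame M -> constant_lambda_extension lambda i t ->
      holds (t lambda) (Imp (conjunction Psi) (disjunction Phi))) ->
    analytic_D2seq ArrowD Psi Phi.
  move=> valid; apply: NNPP => /(completeness lambda_limit.1)[M [Mp [i [t [GL cst]]]]].
  by apply; apply/sequent_trueP; apply: valid cst.
have const_sub (valid : forall (M Mp : model PropVar) (i : M -> Mp) (t : O -> Mp),
      GL_frame M -> lambda_extension lambda i t ->
      holds (t lambda) (Imp (conjunction Psi) (disjunction Phi))) :
    analytic_D2seq ArrowD Psi Phi.
  by apply: complete => M Mp i t GL [ext _]; apply: valid ext.
tfae.
(* Cuts are made analytic semantically: soundness of the full calculus, then completeness of the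
   analytic one. *)
- by move=> p; apply: const_sub; apply: sound.
- by move=> /weaken/sound valid M Mp i t GL [ext _]; apply: valid ext.
- by move=> /complete/weaken/sound.
- by move=> /const_sub/weaken.
Qed.
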